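(* Let $H$ be a complex Hilbert space and let $D$ be any (possibly unbounded) self-adjoint operator on $H$. Let $\delta^D_w$ be the weak derivation on $B(H)$ associated with $D$. Then for every natural number $n\ge 1$, $$\ker (\delta^{D}_w)^n=\ker \delta^{D}_w.$$
   Context: $B(H)$ is the algebra of bounded linear operators on $H$. For $t\in\mathbb{R}$ and $x\in B(H)$ put $\alpha_t(x)=e^{itD}xe^{-itD}$. An operator $x\in B(H)$ is called weakly $D$-differentiable, written $x\in \operatorname{dom}\delta^D_w$, if there exists $y\in B(H)$ such that for every $h,k\in H$, $$\lim_{t\to 0}\left|\left\langle \left(\frac{\alpha_t(x)-x}{t}-y\right)h,k\right\rangle\right|=0;$$ in this case $\delta^D_w(x):=y$. Powers are taken with their natural domains: $x\in\operatorname{dom}(\delta^D_w)^n$ means that $(\delta^D_w)^k(x)\in\operatorname{dom}\delta^D_w$ for every $k=0,\dots,n-1$, and $\ker(\delta^D_w)^n=\{x\in\operatorname{dom}(\delta^D_w)^n : (\delta^D_w)^n(x)=0\}$. *)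

(* Defs.v *)
From HB Require Import structures.
From mathcomp Require Import all_boot all_order all_algebra sesquilinear complex.
From mathcomp Require Import all_classical all_reals all_analysis.

Set Implicit Arguments.
Unset Strict Implicit.
Unset Printing Implicit Defensive.

Import Order.TTheory GRing.Theory Num.Theory.
Import numFieldNormedType.Exports.

Local Open Scope classical_set_scope.
Local Open Scope complex_scope.
Local Open Scope ring_scope.

HB.mixin Record CompleteNormedModule_isHilbert (R : realType) H
    & CompleteNormedModule R[i] H := {
  (* linear in the first argument, conjugate-linear in the second *)
  inner : {dot H for Num.conj} ;
  sqr_normE : forall h : H, `|h| ^+ 2 = inner h h }.

#[short(type="hilbertType")]
HB.structure Definition Hilbert (R : realType) :=
  { H of CompleteNormedModule R[i] H & CompleteNormedModule_isHilbert R H }.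

Notation "''[' u , v ]" := (inner u%R v%R) : ring_scope.

Section Operators.
Context (R : realType) (H : hilbertType R).

(* B(H), as a set of functions *)
Definition bounded_operator : set (H -> H) :=
  [set x | linear x /\ exists M : R, forall h, `|x h| <= M%:C * `|h|].

(* The values of [opfun] outside [opdom] are irrelevant. *)
Record operator := Operator {
  opdom : set H ;
  opfun :> H -> H ;
  opdom0 : opdom 0 ;
  opdom_lin : forall (a : R[i]) h k,
    opdom h -> opdom k -> opdom (a *: h + k) ;
  opfun_lin : forall (a : R[i]) h k,
    opdom h -> opdom k -> opfun (a *: h + k) = a *: opfun h + opfun k }.

(* (k, z) belongs to the graph of the adjoint of D *)
Definition adjoint_graph (D : operator) (k z : H) :=
  forall h, opdom D h -> '[D h, k] = '[h, z].

Definition self_adjoint (D : operator) :=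
  dense (opdom D) /\
  forall k z, adjoint_graph D k z <-> opdom D k /\ D k = z.

End Operators.

Section ProjectionValuedMeasures.
Context (R : realType) (H : hilbertType R).

(* Only the values on Borel sets are relevant. *)
Record pvm := Pvm {
  proj :> set (measurableTypeR R) -> H -> H ;
  proj_bounded : forall A, measurable A -> bounded_operator (proj A) ;
  proj_adj : forall A h k, measurable A -> '[proj A h, k] = '[h, proj A k] ;
  proj0 : forall h, proj set0 h = 0 ;
  projT : forall h, proj setT h = h ;
  projI : forall A B h, measurable A -> measurable B ->
    proj (A `&` B) h = proj A (proj B h) ;
  proj_sigma_additive : forall F : (set (measurableTypeR R))^nat,
    (forall n, measurable (F n)) -> trivIset setT F ->
    forall h, \sum_(0 <= i < n) proj (F i) h @[n --> \oo]
                --> proj (\bigcup_n F n) h }.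

(* The measure A |-> <E(A) h, h>, see [spectral_distE]; the squared norm is
   nonnegative also on sets that are not Borel. *)
Definition spectral_dist (E : pvm) (h : H)
    (A : set (measurableTypeR R)) : \bar R :=
  (complex.Re `|E A h| ^+ 2)%:E.

Section SpectralDist.
Variables (E : pvm) (h : H).
Local Notation mu := (spectral_dist E h).

Lemma Re_norm_ge0 (u : H) : 0 <= complex.Re `|u|.
Proof. by have := normr_ge0 u; rewrite lecE => /andP[]. Qed.

Lemma Re_normE (u : H) : (complex.Re `|u|)%:C = `|u|.
Proof.
by have := normr_ge0 u; rewrite lecE; case: `|u| => a b /= /andP[/eqP -> _].
Qed.

Lemma sqr_Re_normE (u : H) : ((complex.Re `|u|) ^+ 2)%:C = '[u, u].
Proof. by rewrite rmorphXn /= Re_normE sqr_normE. Qed.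

Lemma projM A B (u v : H) : measurable A -> measurable B ->
  '[E A u, E B v] = '[E (A `&` B) u, v].
Proof. by move=> mA mB; rewrite setIC projI // [RHS]proj_adj. Qed.

Lemma spectral_distE (A : set (measurableTypeR R)) : measurable A ->
  mu A = (complex.Re '[E A h, h])%:E.
Proof.
move=> mA; congr (_%:E); have := sqr_Re_normE (E A h).
by rewrite projM // setIid => <-.
Qed.

Let mu0 : mu set0 = 0%E.
Proof. by rewrite /spectral_dist proj0 normr0 expr0n. Qed.

Let mu_ge0 A : (0 <= mu A)%E.
Proof. by rewrite lee_fin sqr_ge0. Qed.

Let mu_sigma_additive : semi_sigma_additive mu.
Proof.
move=> F mF tF mUF.
have sumE n : (\sum_(0 <= i < n) mu (F i))%E =
    ((complex.Re `|\sum_(0 <= i < n) E (F i) h|) ^+ 2)%:E.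
  rewrite sumEFin; congr (_%:E); apply: (fmorph_inj (real_complex R)) => /=.
  elim: n => [|n IHn]; first by rewrite !big_nil /= normr0 expr0n.
  rewrite !big_nat_recr //= rmorphD /= IHn !sqr_Re_normE hnormDd //.
  rewrite -[LHS]/(applyr inner (E (F n) h) _) raddf_sum /= big_nat big1 //.
  move=> i /andP[_ ltin]; rewrite /applyr.
  rewrite projM //; have/trivIsetP/(_ i n I I) -> := tF; last by rewrite ltn_eqF.
  by rewrite proj0 linear0l.
rewrite (_ : (fun n => _) = EFin \o
   (fun n => (complex.Re `|\sum_(0 <= i < n) E (F i) h|) ^+ 2)); last first.
  by apply/funext => n; rewrite /= sumE.
apply: cvg_EFin; first by apply: nearW.
apply: (@cvg_comp _ _ _ (fun n => complex.Re `|\sum_(0 <= i < n) E (F i) h|)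
  (fun r : R => r ^+ 2) _ (nbhs (complex.Re `|E (\bigcup_n F n) h|))); last first.
  exact: exprn_continuous.
apply/cvgrPdist_lt => e e0.
have /cvgrPdist_lt/(_ e%:C) := @proj_sigma_additive E F mF tF h.
rewrite ltcR => /(_ e0); apply: filterS => n lte.
rewrite -ltcR; apply: le_lt_trans lte.
apply: le_trans (ler_dist_dist _ _).
by apply: le_trans (normc_ge_Re _); rewrite raddfB.
Qed.

HB.instance Definition _ :=
  isMeasure.Build _ _ _ mu mu0 mu_ge0 mu_sigma_additive.

End SpectralDist.
End ProjectionValuedMeasures.

Section WeakDerivation.
Context (R : realType) (H : hilbertType R).
Implicit Types (D : operator H) (E : pvm H) (x y : H -> H).

(* x = \int f dE, for a bounded Borel function f; by polarization, x is
   determined by its quadratic form. *)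
Definition spectral_integral E (f : measurableTypeR R -> R[i]) x :=
  bounded_operator x /\
  forall h, '[x h, h] =
    (\int[spectral_dist E h]_s complex.Re (f s)) +i*
    (\int[spectral_dist E h]_s complex.Im (f s)).

(* D = \int s dE(s), with its natural domain *)
Definition spectral_resolution D E :=
  (forall h, opdom D h <->
     (\int[spectral_dist E h]_s ((s : R) ^+ 2)%:E < +oo)%E) /\
  (forall h, opdom D h ->
     '[D h, h] = (\int[spectral_dist E h]_s (s : R))%:C).

(* [expi D t] is e^{itD}, given by the Borel functional calculus.  By the
   spectral theorem, a self-adjoint D has a spectral resolution, unique on Borel
   sets: the set of the [U] is a singleton and the default value is not taken. *)
Definition expi D : R -> H -> H :=
  xget ((fun _ h => h) : R -> H -> H)
    [set U : R -> H -> H | exists2 E, spectral_resolution D E &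
       forall t, spectral_integral E
         (fun s : R => cos (t * s) +i* sin (t * s)) (U t)].

Definition alpha D (t : R) x : H -> H := expi D t \o x \o expi D (- t).

Definition weak_derivative D x y :=
  [/\ bounded_operator x, bounded_operator y &
    forall h k,
      `|'[t%:C^-1 *: (alpha D t x h - x h) - y h, k]| @[t --> (0 : R)^']
        --> (0 : R[i]^o)].

Definition dom_delta D : set (H -> H) :=
  [set x | exists y, weak_derivative D x y].

(* y is unique when it exists *)
Definition delta D x : H -> H := xget (cst 0) [set y | weak_derivative D x y].

Definition ker_delta D : set (H -> H) :=
  [set x | dom_delta D x /\ delta D x = cst 0].

Definition dom_delta_pow D n : set (H -> H) :=
  [set x | bounded_operator x /\
           forall k, (k < n)%N -> dom_delta D (iter k (delta D) x)].

Definition ker_delta_pow D n : set (H -> H) :=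
  [set x | dom_delta_pow D n x /\ iter n (delta D) x = cst 0].

End WeakDerivation.

(* Main.v *)
Require Import Defs.
From mathcomp Require Import all_boot all_order all_algebra.
From mathcomp Require Import all_classical all_reals all_analysis.
From mathcomp Require Import sesquilinear complex measurable_realfun ring lra.

Set Implicit Arguments.
Unset Strict Implicit.
Unset Printing Implicit Defensive.

Import Order.TTheory GRing.Theory Num.Theory.
Import numFieldNormedType.Exports.

Local Open Scope classical_set_scope.
Local Open Scope complex_scope.
Local Open Scope ring_scope.

(** For the unitary group U(t) = e^{itD} and h, k in H, the function
    t |-> Re <alpha_t(x) h, k> is bounded, and if x is weakly differentiable its
    derivative at every t is Re <alpha_t(delta x) h, k>.  If moreover
    delta (delta x) = 0, that derivative is constant, so the function is affine and
    bounded, hence constant, and delta x = 0.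

    That U is a group rests on the multiplicativity of f |-> \int f dE.  Such an
    integral commutes with the projections E(A), and on the range of E(A) it is
    close to c when f is close to c on A.  So on each cell of a countable partition
    of the line into sets where f and g are almost constant, \int f g dE is close to
    (\int f dE) (\int g dE). *)

(** * Real and imaginary parts of complex numbers *)

Section ComplexParts.
Context (R : realType).
Implicit Types z w : R[i].

Lemma complex_ReIm z w :
  complex.Re z = complex.Re w -> complex.Im z = complex.Im w -> z = w.
Proof. by case: z w => a b [c d] /= -> ->. Qed.

Lemma Re_sub z w : complex.Re (z - w) = complex.Re z - complex.Re w.
Proof. by case: z w => a b [c d]. Qed.

Lemma Im_sub z w : complex.Im (z - w) = complex.Im z - complex.Im w.
Proof. by case: z w => a b [c d]. Qed.

Lemma Re_mul z w : complex.Re (z * w) =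
  complex.Re z * complex.Re w - complex.Im z * complex.Im w.
Proof. by case: z w => a b [c d]. Qed.

Lemma Im_mul z w : complex.Im (z * w) =
  complex.Re z * complex.Im w + complex.Im z * complex.Re w.
Proof. by case: z w => a b [c d]. Qed.

Lemma Re_conj z : complex.Re (Num.conj z) = complex.Re z.
Proof. by case: z. Qed.

Lemma Im_conj z : complex.Im (Num.conj z) = - complex.Im z.
Proof. by case: z. Qed.

Lemma conj_i : Num.conj ('i%C : R[i]) = - 'i%C.
Proof. by apply: complex_ReIm; rewrite /= ?oppr0. Qed.

Lemma sqr_normc_ReIm z :
  complex.Re `|z| ^+ 2 = complex.Re z ^+ 2 + complex.Im z ^+ 2.
Proof. by rewrite normc_def /= sqr_sqrtr// addr_ge0 ?sqr_ge0. Qed.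

Lemma normc_le_ReIm z (e : R) : `|z| <= e%:C ->
  `|complex.Re z| <= e /\ `|complex.Im z| <= e.
Proof.
rewrite normc_def lecR => le_e; split; apply: le_trans le_e.
  by rewrite -sqrtr_sqr ler_wsqrtr// lerDl sqr_ge0.
by rewrite -sqrtr_sqr ler_wsqrtr// lerDr sqr_ge0.
Qed.

Lemma normc_le_half z (e : R) : `|complex.Re z| <= e / 2 ->
  `|complex.Im z| <= e / 2 -> `|z| <= e%:C.
Proof.
move=> zRe zIm; have e0 : 0 <= e / 2 by exact: le_trans zRe.
rewrite normc_def lecR -[leRHS]ger0_norm//; last by lra.
rewrite -sqrtr_sqr ler_wsqrtr// -(real_normK (num_real (complex.Re z))).
rewrite -(real_normK (num_real (complex.Im z))).
have := normr_ge0 (complex.Re z); have := normr_ge0 (complex.Im z); nra.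
Qed.

End ComplexParts.

(** * Inner products, polarization and the numerical radius *)

Section InnerProduct.
Context (R : realType) (H : hilbertType R).
Implicit Types (u v w : H) (x y : H -> H).

(** Real-valued, and spelled as in [spectral_dist], so that [sqn (E A h)] is by conversion the mass
    that the measure of [h] gives to [A]. *)
Definition sqn u : R := complex.Re `|u| ^+ 2.

Lemma sqn_ge0 u : 0 <= sqn u.
Proof. exact: sqr_ge0. Qed.

Lemma innerE u : '[u, u] = (sqn u)%:C.
Proof. by rewrite /sqn sqr_Re_normE. Qed.

Lemma sqnE u : sqn u = complex.Re '[u, u].
Proof. by rewrite innerE. Qed.

Lemma sqn0 : sqn 0 = 0.
Proof. by rewrite sqnE linear0l. Qed.

Lemma sqn_eq0 u : sqn u = 0 -> u = 0.
Proof.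
move=> u0; apply/eqP; rewrite -normr_eq0 -sqrf_eq0 sqr_normE innerE u0.
by [].
Qed.

Lemma innerDl u v w : '[u + v, w] = '[u, w] + '[v, w].
Proof. exact: linearDl. Qed.
Lemma innerDr u v w : '[w, u + v] = '[w, u] + '[w, v].
Proof. exact: linearDr. Qed.
Lemma innerBl u v w : '[u - v, w] = '[u, w] - '[v, w].
Proof. exact: linearBl. Qed.
Lemma innerBr u v w : '[w, u - v] = '[w, u] - '[w, v].
Proof. exact: linearBr. Qed.
Lemma innerZl a u v : '[a *: u, v] = a * '[u, v].
Proof. exact: linearZl_LR. Qed.
Lemma innerZr a u v : '[u, a *: v] = Num.conj a * '[u, v].
Proof. exact: linearZr_LR. Qed.
Lemma innerC u v : '[u, v] = Num.conj '[v, u].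
Proof. by rewrite hermC expr0 mul1r. Qed.

Lemma sqnZ a u : sqn (a *: u) = complex.Re `|a| ^+ 2 * sqn u.
Proof.
rewrite sqnE innerZl innerZr innerE mulrA sqr_normc_ReIm.
by rewrite !Re_mul /= Re_conj Im_conj; ring.
Qed.

Lemma parallelogram u v : sqn (u + v) + sqn (u - v) = 2 * (sqn u + sqn v).
Proof.
rewrite !sqnE innerBl innerDl !(innerBr, innerDr) !(raddfD, raddfB) /=.
by rewrite !raddfN /=; ring.
Qed.

Lemma sqn_i u : sqn ('i%C *: u) = sqn u.
Proof. by rewrite sqnZ sqr_normc_ReIm /=; ring. Qed.

Lemma sqnD_le u v : sqn (u + v) <= 2 * (sqn u + sqn v).
Proof. by rewrite -parallelogram lerDl sqn_ge0. Qed.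

(** From [0 <= sqn (u - v)]. This weak form of Cauchy-Schwarz serves wherever the constant does not
    matter. *)
Lemma Re_inner_le u v : 2 * complex.Re '[u, v] <= sqn u + sqn v.
Proof.
have := sqn_ge0 (u - v).
rewrite sqnE innerBl !innerBr !innerE (innerC v u) !(raddfB, raddfD) /=.
by rewrite !raddfN /= Re_conj; lra.
Qed.

(** Real parts suffice: at [w = u - v] the difference of the two sides is [sqn (u - v)]. *)
Lemma inner_inj u v : (forall w, complex.Re '[u, w] = complex.Re '[v, w]) -> u = v.
Proof.
move=> uv; apply/eqP; rewrite -subr_eq0; apply/eqP/sqn_eq0.
by rewrite sqnE innerBl raddfB /= uv subrr.
Qed.

(** The diagonal value at [u + v] makes [B] antisymmetric and the one at [u + i v] makes it
    symmetric, so [B] vanishes. *)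
Lemma polarization0 (B : H -> H -> R[i]) :
  (forall u v w, B (u + v) w = B u w + B v w) ->
  (forall u v w, B w (u + v) = B w u + B w v) ->
  (forall u v, B ('i%C *: u) v = 'i%C * B u v) ->
  (forall u v, B u ('i%C *: v) = - 'i%C * B u v) ->
  (forall u, B u u = 0) -> forall u v, B u v = 0.
Proof.
move=> BDl BDr Bil Bir B0 u v.
have := B0 (u + v); rewrite BDl !BDr !B0 add0r addr0 => B1.
have := B0 (u + 'i%C *: v); rewrite BDl !BDr !B0 add0r addr0 Bil Bir => B2.
move/eqP: B1 B2; rewrite addr_eq0 => /eqP ->.
rewrite mulrNN -mulrDr => /eqP; rewrite mulf_eq0 => /orP[|].
  by rewrite eq_complex /= oner_eq0 andbF.
by rewrite -mulr2n mulrn_eq0 /= => /eqP ->; rewrite oppr0.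
Qed.

Section Linear.
Variables (x : H -> H) (lx : linear x).
Lemma linopD u v : x (u + v) = x u + x v.
Proof. by rewrite -[u]scale1r lx !scale1r. Qed.
Lemma linop0 : x 0 = 0.
Proof. by apply: (addIr (x 0)); rewrite -linopD !add0r. Qed.
Lemma linopZ a u : x (a *: u) = a *: x u.
Proof. by rewrite -[a *: u]addr0 lx linop0 addr0. Qed.
Lemma linopB u v : x (u - v) = x u - x v.
Proof. by rewrite linopD -scaleN1r linopZ scaleN1r. Qed.
End Linear.

(** Since [spectral_integral] prescribes only the quadratic form, equalities between such operators
    are reduced to the diagonal by this lemma. *)
Lemma quadratic_inj x y : linear x -> linear y ->
  (forall u, '[x u, u] = '[y u, u]) -> x = y.
Proof.
move=> lx ly xy; apply/funext => u; apply: inner_inj => v.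
pose B u v := '[x u - y u, v].
suff: B u v = 0.
  by rewrite /B innerBl => /eqP; rewrite subr_eq0 => /eqP ->.
apply: polarization0 => [a b w|a b w|a b|a b|a]; rewrite /B.
- by rewrite (linopD lx) (linopD ly) -innerDl opprD addrACA.
- by rewrite innerDr.
- by rewrite (linopZ lx) (linopZ ly) -scalerBr innerZl.
- by rewrite innerZr conj_i.
- by rewrite innerBl xy subrr.
Qed.

Lemma quadratic_expand x a u v : linear x ->
  '[x (a *: v + u), a *: v + u] = '[x u, u] + Num.conj a * '[x u, v] +
    a * '[x v, u] + a * (Num.conj a * '[x v, v]).
Proof. by move=> lx; rewrite lx innerDl !innerDr !innerZl !innerZr; ring. Qed.

(* The constant 4 is the square of the 2 relating the norm of an operator to
   its numerical radius. *)
Lemma numerical_radius_le (V : set H) x (e : R) : 0 < e ->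
  (forall a u v, V u -> V v -> V (a *: u + v)) ->
  (forall u, V u -> V (x u)) -> linear x ->
  (forall u, V u -> `|complex.Re '[x u, u]| <= e * sqn u) ->
  (forall u, V u -> `|complex.Im '[x u, u]| <= e * sqn u) ->
  forall u, V u -> sqn (x u) <= 4 * e ^+ 2 * sqn u.
Proof.
move=> e0 Vlin Vx lx xRe xIm u Vu.
(* Four times the left side is a signed sum of the real parts of the form at [u + v], [u - v] and
   its imaginary parts at [u + i v], [u - i v]. Each is at most [e] times a squared norm, and two
   parallelogram laws add these up. *)
have le_inner v : V v -> complex.Re '[x u, v] <= e * (sqn u + sqn v).
  move=> Vv.
  have V1 : V (1 *: v + u) by apply: Vlin.
  have V2 : V (-1 *: v + u) by apply: Vlin.
  have V3 : V ('i%C *: v + u) by apply: Vlin.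
  have V4 : V (- 'i%C *: v + u) by apply: Vlin.
  have := xRe _ V1; rewrite (quadratic_expand _ _ _ lx) ler_norml => /andP[_].
  have := xRe _ V2; rewrite (quadratic_expand _ _ _ lx) ler_norml => /andP[+ _].
  have := xIm _ V3; rewrite (quadratic_expand _ _ _ lx) ler_norml => /andP[+ _].
  have := xIm _ V4; rewrite (quadratic_expand _ _ _ lx) ler_norml => /andP[_].
  rewrite !(addrC _ u) !scaleNr !scale1r.
  have := parallelogram u v; have := parallelogram u ('i%C *: v).
  rewrite sqn_i.
  move: (sqn (u + v)) (sqn (u - v)) (sqn (u + _)) (sqn (u - _)).
  move: (sqn u) (sqn v) => a b c1 c2 c3 c4.
  move: '[x u, u] '[x u, v] '[x v, u] '[x v, v].
  case=> [z1 t1] [z2 t2] [z3 t3] [z4 t4] /=.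
  rewrite !(mul0r, mulr0, mul1r, mulr1, subr0, sub0r, oppr0, mulNr, mulrN, opprK, add0r, addr0).
  move=> E1 E2 h4 h3 h2 h1.
  have := congr1 ( *%R e) E1; have := congr1 ( *%R e) E2; lra.
have r0 : 0 < (2 * e)^-1 by rewrite invr_gt0 mulr_gt0.
(* The vector [v = r x u] with [r = 1 / (2 e)] minimizes [e r ^ 2 sqn (x u) - r sqn (x u)], the part
   of the bound that depends on [r]; multiplying by [4 e] then gives the claim. *)
have Vr : V (((2 * e)^-1)%:C *: x u).
  rewrite -[_ *: _]addr0; apply: (Vlin) (Vx _ Vu) _.
  by rewrite -(addNr u) -scaleN1r; apply: Vlin.
have := le_inner _ Vr; rewrite sqnZ innerZr innerE !Re_mul sqr_normc_ReIm /=.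
rewrite expr0n /= addr0 oppr0 mulr0 subr0.
have : (2 * e) * (2 * e)^-1 = 1 by rewrite divff// gt_eqF// mulr_gt0.
move: (2 * e)^-1 r0 (sqn (x u)) (sqn u) => r r0 a b re h.
have : 0 <= (e * (b + r ^+ 2 * a) - r * a) * (4 * e).
  by apply: mulr_ge0; [rewrite subr_ge0|lra].
have -> : (e * (b + r ^+ 2 * a) - r * a) * (4 * e) =
  4 * e ^+ 2 * b + (2 * e * r) ^+ 2 * a - 2 * (2 * e * r) * a by ring.
rewrite re; lra.
Qed.

End InnerProduct.

(** * Integrals against a projection-valued measure *)

Section SpectralCalculus.
Context (R : realType) (H : hilbertType R) (E : pvm H).
Implicit Types (A B : set (measurableTypeR R)) (u h : H) (x y : H -> H).
Implicit Types (f g : measurableTypeR R -> R[i]).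
Local Notation mu := (spectral_dist E).

Lemma proj_linear A : measurable A -> linear (E A).
Proof. by move=> /(proj_bounded E)[]. Qed.

Lemma proj_idem A h : measurable A -> E A (E A h) = E A h.
Proof. by move=> mA; rewrite -projI// setIid. Qed.

Lemma proj_disjoint A B h : measurable A -> measurable B -> A `&` B = set0 ->
  E A (E B h) = 0.
Proof. by move=> mA mB AB; rewrite -projI// AB proj0. Qed.

Lemma spectral_dist_fin h A : (mu h A < +oo)%E.
Proof. exact: ltry. Qed.

Lemma spectral_dist_projS A B h : measurable A -> measurable B -> B `<=` A ->
  mu (E A h) B = mu h B.
Proof. by move=> mA mB BA; rewrite /spectral_dist -projI// setIidl. Qed.

Lemma spectral_integrable (r : measurableTypeR R -> R) A h :
  measurable A -> measurable_fun setT r ->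
  (exists M : R, forall s, `|r s| <= M) -> (mu h).-integrable A (EFin \o r).
Proof.
move=> mA mr [M rM]; apply: measurable_bounded_integrable => //.
- exact: spectral_dist_fin.
- exact: measurable_funS mr.
- exists M; split; first exact: num_real.
  by move=> N MN s _; apply: le_trans (rM s) (ltW MN).
Qed.

Section RealIntegrand.
Variable r : measurableTypeR R -> R.
Hypotheses (mr : measurable_fun setT r) (br : exists M : R, forall s, `|r s| <= M).

Lemma spectral_Rintegral_split A h : measurable A ->
  \int[mu h]_s r s = \int[mu h]_(s in A) r s + \int[mu h]_(s in ~` A) r s.
Proof.
move=> mA; rewrite -[in LHS](setUv A) Rintegral_setU//; first exact: measurableC.
- by rewrite setUv; apply: spectral_integrable.
- exact/disj_setPCl.
Qed.

(** The measure of [E A h] is that of [h] restricted to [A]: both agree on subsets of [A], and the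
    former gives no mass to the complement. *)
Lemma spectral_Rintegral_proj A h : measurable A ->
  \int[mu (E A h)]_s r s = \int[mu h]_(s in A) r s.
Proof.
move=> mA; rewrite (spectral_Rintegral_split _ mA) [X in _ + X]/Rintegral.
rewrite null_set_integral ?addr0.
- congr fine; apply: eq_measure_integral => B mB BA.
  exact: spectral_dist_projS.
- exact: measurableC.
- apply/measurable_EFinP; exact: measurable_funS mr.
- rewrite -[LHS]/((complex.Re `|E (~` A) (E A h)| ^+ 2)%:E).
  rewrite proj_disjoint ?setICl//; last exact: measurableC.
  by rewrite normr0 expr0n.
Qed.

Lemma spectral_Rintegral_near_cst A h (c e : R) : measurable A ->
  (forall s, A s -> `|r s - c| <= e) ->
  `|\int[mu (E A h)]_s r s - c * sqn (E A h)| <= e * sqn (E A h).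
Proof.
move=> mA rc; rewrite spectral_Rintegral_proj//.
have fin : fine (mu h A) = sqn (E A h) by [].
have ir := spectral_integrable h mA mr br.
have ic (k : R) : (mu h).-integrable A (EFin \o cst k).
  by apply: spectral_integrable => //; exists `|k|.
have h1 : \int[mu h]_(s in A) r s <= (c + e) * sqn (E A h).
  rewrite -fin -Rintegral_cst//; apply: le_Rintegral => // [|s /rc].
    exact: ic.
  by rewrite ler_norml => /andP[_]; rewrite lerBlDl.
have h2 : (c - e) * sqn (E A h) <= \int[mu h]_(s in A) r s.
  rewrite -fin -Rintegral_cst//; apply: le_Rintegral => // [|s /rc].
    exact: ic.
  by rewrite ler_norml => /andP[+ _]; rewrite lerBrDl.
move: h1 h2; rewrite ler_norml.
move: (\int[mu h]_(s in A) r s) (sqn (E A h)) => I q; clear => h1 h2.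
by apply/andP; split; lra.
Qed.

End RealIntegrand.

Definition bounded_borel f := [/\ measurable_fun setT (fun s => complex.Re (f s)),
  measurable_fun setT (fun s => complex.Im (f s)) & exists M : R, forall s, `|f s| <= M%:C].

Lemma bounded_borel_Re f : bounded_borel f ->
  exists M : R, forall s, `|complex.Re (f s)| <= M.
Proof. by move=> [_ _ [M fM]]; exists M => s; case: (normc_le_ReIm (fM s)). Qed.

Lemma bounded_borel_Im f : bounded_borel f ->
  exists M : R, forall s, `|complex.Im (f s)| <= M.
Proof. by move=> [_ _ [M fM]]; exists M => s; case: (normc_le_ReIm (fM s)). Qed.

(** Splitting the integrals over [A] and its complement shows that [x] has the same quadratic form
    as its block-diagonal part with respect to [E A], hence equals it. *)
Lemma spectral_integral_proj_comm f x A h : bounded_borel f ->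
  spectral_integral E f x -> measurable A -> x (E A h) = E A (x h).
Proof.
move=> bf [[lx _] xE] mA; have mAc := measurableC mA.
have lA := proj_linear mA; have lAc := proj_linear mAc.
have xD : x = fun u => E A (x (E A u)) + E (~` A) (x (E (~` A) u)).
  apply: quadratic_inj => // [a u v|u].
    by rewrite lA lAc !lx lA lAc scalerDr addrACA.
  rewrite innerDl !proj_adj// !xE; have [mRe mIm _] := bf.
  have bRe := bounded_borel_Re bf; have bIm := bounded_borel_Im bf.
  rewrite (spectral_Rintegral_split mRe bRe _ mA).
  rewrite (spectral_Rintegral_split mIm bIm _ mA).
  rewrite (spectral_Rintegral_proj mRe bRe _ mA).
  rewrite (spectral_Rintegral_proj mRe bRe _ mAc).
  rewrite (spectral_Rintegral_proj mIm bIm _ mA).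
  by rewrite (spectral_Rintegral_proj mIm bIm _ mAc).
rewrite xD /= proj_idem// (proj_disjoint _ mAc mA) ?setICl//.
rewrite (linop0 lx) (linop0 lAc) addr0.
rewrite (linopD lA) proj_idem// (proj_disjoint _ mA mAc) ?setICr//.
by rewrite addr0.
Qed.

(** On the range of [E A], which [x] preserves by commutation, the quadratic form of [x - c] is the
    integral of [f - c] over [A]. It is thus small, and [numerical_radius_le] turns this into a norm
    bound. *)
Lemma spectral_integral_near_cst f x A u (c : R[i]) (e : R) :
  bounded_borel f -> spectral_integral E f x -> measurable A -> 0 < e ->
  (forall s, A s -> `|f s - c| <= e%:C) -> E A u = u ->
  sqn (x u - c *: u) <= 4 * e ^+ 2 * sqn u.
Proof.
move=> bf ix mA e0 fc; have [[lx _] xE] := ix; have [mRe mIm _] := bf.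
have lA := proj_linear mA.
pose V : set H := [set v | E A v = v].
apply: (@numerical_radius_le _ _ V (fun v => x v - c *: v)) => //.
- by move=> a v w /= Vv Vw; rewrite /V/= lA Vv Vw.
- move=> v /= Vv; rewrite /V/= (linopB lA) (linopZ lA) Vv.
  by rewrite -(spectral_integral_proj_comm _ bf ix mA) Vv.
- move=> a v w; rewrite lx scalerDr scalerA mulrC -scalerA scalerBr.
  by rewrite opprD addrACA.
- move=> v /= Vv; rewrite innerBl innerZl innerE xE Re_sub Re_mul /= mulr0 subr0.
  rewrite -Vv; apply: (spectral_Rintegral_near_cst mRe (bounded_borel_Re bf)) => //.
  by move=> s /fc/normc_le_ReIm[+ _]; rewrite Re_sub.
- move=> v /= Vv; rewrite innerBl innerZl innerE xE Im_sub Im_mul /= mulr0 add0r.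
  rewrite -Vv; apply: (spectral_Rintegral_near_cst mIm (bounded_borel_Im bf)) => //.
  by move=> s /fc/normc_le_ReIm[_]; rewrite Im_sub.
Qed.

End SpectralCalculus.

(** * Countable measurable partitions of the line *)

Section Labellings.
Context (R : realType).
Implicit Types (k : measurableTypeR R -> nat) (f : measurableTypeR R -> R[i]).

(* A countable measurable partition, given by the index of the cell of a point. *)
Definition measurable_labelling k := forall n, measurable [set s | k s = n].

(** Coding by [pickle] keeps all partitions indexed by [nat], as sigma-additivity requires; a number
    that codes nothing labels an empty cell. *)
Lemma labelling_of_countType (T : countType) (c : measurableTypeR R -> T) :
  (forall i, measurable [set s | c s = i]) ->
  measurable_labelling (fun s => pickle (c s)).
Proof.
move=> mc n; have [[i in_i]|none] := pselect (exists i : T, pickle i = n).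
  rewrite (_ : [set _ | _] = [set s | c s = i]) //.
  apply/seteqP; split=> s /=; last by move=> ->.
  by rewrite -in_i; exact: (pcan_inj pickleK).
rewrite (_ : [set _ | _] = set0)//; apply/seteqP; split=> s //= sn.
by apply: none; exists (c s).
Qed.

Lemma labelling_pair k1 k2 : measurable_labelling k1 ->
  measurable_labelling k2 ->
  measurable_labelling (fun s => pickle (k1 s, k2 s)).
Proof.
move=> m1 m2; apply: labelling_of_countType => -[n1 n2].
rewrite (_ : [set _ | _] = [set s | k1 s = n1] `&` [set s | k2 s = n2]).
  exact: measurableI.
by apply/seteqP; split=> s /= [-> ->].
Qed.

Lemma real_labelling (r : measurableTypeR R -> R) (e : R) :
  0 < e -> measurable_fun setT r -> exists2 k, measurable_labelling k &
    forall s t, k s = k t -> `|r s - r t| <= e.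
Proof.
(* The label codes the integer [i] for which [r s] lies in the half-open interval from [i e] to
   [(i + 1) e]. *)
move=> e0 mr; exists (fun s => pickle (Num.floor (r s / e))).
  apply: labelling_of_countType => i.
  rewrite (_ : [set _ | _] = r @^-1` `[i%:~R * e, (i + 1)%:~R * e[).
    by rewrite -[X in measurable X]setTI; exact: mr.
  apply/seteqP; split=> s /=; rewrite in_itv/= -ler_pdivlMr// -ltr_pdivrMr//.
    by move/eqP; rewrite floor_eq.
  by rewrite -floor_eq => /eqP.
move=> s t /(pcan_inj pickleK) st.
have := floor_itv (r s / e); have := floor_itv (r t / e); rewrite st.
rewrite !ler_pdivlMr// !ltr_pdivrMr// intrD => /andP[t1 t2] /andP[s1 s2].
by rewrite ler_norml; apply/andP; split; lra.
Qed.

Lemma complex_labelling f (e : R) : 0 < e -> bounded_borel f ->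
  exists2 k, measurable_labelling k &
    forall s t, k s = k t -> `|f s - f t| <= e%:C.
Proof.
move=> e0 [mRe mIm _]; have e2 : 0 < e / 2 by rewrite divr_gt0.
have [k1 mk1 k1P] := real_labelling e2 mRe.
have [k2 mk2 k2P] := real_labelling e2 mIm.
exists (fun s => pickle (k1 s, k2 s)); first exact: labelling_pair.
move=> s t /(pcan_inj pickleK)[/k1P + /k2P]; rewrite -Re_sub -Im_sub.
exact: normc_le_half.
Qed.

End Labellings.

(** * Multiplicativity of the spectral integral *)

Section Multiplicativity.
Context (R : realType) (H : hilbertType R) (E : pvm H).
Implicit Types (u h : H) (x y w : H -> H) (f g : measurableTypeR R -> R[i]).

(** By sigma-additivity, the squared norm of a vector is the sum of those of its components in the
    cells, so a bound on every cell adds up to a global one. *)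
Lemma spectral_dist_le_labelling (k : measurableTypeR R -> nat) u h (c : R) :
  measurable_labelling k -> 0 <= c ->
  (forall n, sqn (E [set s | k s = n] u) <= c * sqn (E [set s | k s = n] h)) ->
  sqn u <= c * sqn h.
Proof.
move=> mk c0 le_c; rewrite -(projT E u) -(projT E h) -lee_fin (EFinM c).
pose F n := [set s | k s = n].
have tF : trivIset setT F by move=> i j _ _ [s [/= <- <-]].
have UF : \bigcup_n F n = setT by apply/seteqP; split=> s // _; exists (k s).
have muE v : (sqn (E setT v))%:E = (\sum_(n <oo) spectral_dist E v (F n))%E.
  rewrite -measure_semi_bigcup//; first by rewrite UF.
  by rewrite UF; exact: measurableT.
rewrite !muE -nneseriesZl; last by move=> *; exact: measure_ge0.
apply: lee_nneseries => [n _ _|n _]; first exact: measure_ge0.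
rewrite -[X in (_ <= _ * X)%E]/((sqn (E (F n) h))%:E) -EFinM lee_fin.
exact: le_c.
Qed.

Lemma bounded_operator_sqn x : bounded_operator x ->
  exists2 K : R, 0 <= K & forall h, sqn (x h) <= K * sqn h.
Proof.
move=> [lx [M xM]]; exists (M ^+ 2) => [|h]; first exact: sqr_ge0.
have := xM h; rewrite -(Re_normE (x h)) -(Re_normE h) -rmorphM lecR => le_M.
rewrite /sqn -exprMn.
by apply: lerXn2r => //; rewrite nnegrE ?(le_trans _ le_M) ?Re_norm_ge0.
Qed.

Lemma spectral_integral_mul f g x y w :
  bounded_borel f -> bounded_borel g -> bounded_borel (fun s => f s * g s) ->
  spectral_integral E f x -> spectral_integral E g y ->
  spectral_integral E (fun s => f s * g s) w -> w = x \o y.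
Proof.
move=> bf bg bfg ix iy iw; have [bx _] := ix; have [lx _] := bx.
have [[ly _] _] := iy; have [[lw _] _] := iw.
have [K K0 xK] := bounded_operator_sqn bx.
have [M M0 [fM gM]] : exists2 M : R, 0 < M &
    (forall s, `|f s| <= M%:C) /\ (forall s, `|g s| <= M%:C).
  have [_ _ [Mf Mf']] := bf; have [_ _ [Mg Mg']] := bg.
  exists (`|Mf| + `|Mg| + 1); first by rewrite ltr_wpDl ?addr_ge0.
  split=> s; [apply: (le_trans (Mf' s))|apply: (le_trans (Mg' s))];
    rewrite lecR; [have := ler_norm Mf|have := ler_norm Mg];
    have := normr_ge0 Mf; have := normr_ge0 Mg; lra.
(* Collects the final error terms: [2 * 4 * (2 M) ^ 2] from [w], then [2 * 2 * 4 * K] from [y] and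
   [2 * 2 * 4 * M ^ 2] from [x], the factors 2 coming from [sqnD_le]. *)
pose C := 32 * M ^+ 2 + 16 * K + 16 * M ^+ 2.
have C0 : 0 <= C by rewrite !addr_ge0// mulr_ge0// sqr_ge0.
apply/funext => h /=; apply/eqP; rewrite -subr_eq0; apply/eqP/sqn_eq0.
apply/eqP; rewrite eq_le sqn_ge0 andbT; apply/ler_addgt0Pr => eps eps0.
rewrite add0r.
(* Chosen so that [C * e ^ 2 * sqn h <= eps]; the added 1 keeps the denominator positive. *)
pose e := Num.sqrt (eps / (C * sqn h + 1)).
have d0 : 0 < C * sqn h + 1 by rewrite ltr_wpDl// mulr_ge0// sqn_ge0.
have e0 : 0 < e by rewrite sqrtr_gt0 divr_gt0.
have [kf mkf kfP] := complex_labelling e0 bf.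
have [kg mkg kgP] := complex_labelling e0 bg.
pose k s := pickle (kf s, kg s).
have mk : measurable_labelling k by exact: labelling_pair.
suff main n : sqn (E [set s | k s = n] (w h - x (y h))) <=
    C * e ^+ 2 * sqn (E [set s | k s = n] h).
  have := spectral_dist_le_labelling mk (mulr_ge0 C0 (sqr_ge0 e)) main.
  move/le_trans; apply; rewrite sqr_sqrtr; last by rewrite divr_ge0 ?ltW.
  rewrite mulrAC mulrA ler_pdivrMr// mulrDr mulr1 [leLHS]mulrC.
  by rewrite lerDl ltW.
set A := [set s | k s = n]; have mA : measurable A := mk n.
have lA := proj_linear E mA.
(* An empty cell offers no sample point [s0], but its projection is zero. *)
have [[s0 As0]|A0] := pselect (exists s, A s); last first.
  have -> : A = set0.
    by apply/seteqP; split=> s //= As; apply: A0; exists s.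
  by rewrite !proj0 sqn0 mulr0.
rewrite (linopB lA) -(spectral_integral_proj_comm _ bfg iw mA).
rewrite -(spectral_integral_proj_comm _ bf ix mA).
rewrite -(spectral_integral_proj_comm _ bg iy mA).
set u := E A h; have Au : E A u = u by exact: proj_idem.
set a := f s0; set b := g s0.
have near s : A s -> `|f s - a| <= e%:C /\ `|g s - b| <= e%:C.
  move=> As; have : k s = k s0 by rewrite As.
  by move=> /(pcan_inj pickleK)[/kfP ? /kgP].
have xu := spectral_integral_near_cst bf ix mA e0 (fun s As => (near s As).1) Au.
have yu := spectral_integral_near_cst bg iy mA e0 (fun s As => (near s As).2) Au.
have Me0 : 0 < 2 * M * e by rewrite !mulr_gt0.
have wu : sqn (w u - (a * b) *: u) <= 4 * (2 * M * e) ^+ 2 * sqn u.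
  apply: (spectral_integral_near_cst bfg iw mA Me0 _ Au) => s As.
  have [fa gb] := near s As.
  have -> : f s * g s - a * b = (f s - a) * g s + a * (g s - b) by ring.
  apply: (le_trans (ler_normD _ _)); rewrite !normrM.
  rewrite (_ : (2 * M * e)%:C = e%:C * M%:C + M%:C * e%:C).
    by apply: lerD; apply: ler_pM => //; exact: fM.
  by apply: complex_ReIm; rewrite /=; ring.
(* On the cell, [w - x y = (w - a b) - (x (y - b) + b (x - a))]: each difference is small, while [x]
   is bounded through [K] and [b] through [M]. *)
rewrite (_ : w u - x (y u) = (w u - (a * b) *: u) +
   (- 1) *: (x (y u - b *: u) + b *: (x u - a *: u))); last first.
  rewrite (linopB lx) (linopZ lx) scaleN1r scalerBr scalerA (mulrC b a).
  by rewrite (addrA (x (y u) - _)) subrK opprB addrA subrK.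
apply: (le_trans (sqnD_le _ _)); rewrite sqnZ normrN1 expr1n mul1r.
have := sqnD_le (x (y u - b *: u)) (b *: (x u - a *: u)).
have := xK (y u - b *: u); rewrite sqnZ.
have b2 : complex.Re `|b| ^+ 2 <= M ^+ 2.
  have := gM s0; rewrite -/b normc_def lecR => bM.
  by apply: lerXn2r => //; rewrite nnegrE ?sqrtr_ge0 ?ltW.
have h1 : K * sqn (y u - b *: u) <= K * (4 * e ^+ 2 * sqn u) by rewrite ler_wpM2l.
have h2 : complex.Re `|b| ^+ 2 * sqn (x u - a *: u) <= M ^+ 2 * (4 * e ^+ 2 * sqn u).
  by apply: ler_pM => //; rewrite ?sqr_ge0 ?sqn_ge0.
rewrite /C; move: h1 h2 wu; clear.
set q := sqn u.
set t1 := sqn (y u - _); set t2 := sqn (w u - _).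
set t3 := sqn (x (y u - _)); set t4 := _ * sqn (x u - _); set t5 := sqn (_ + _).
move=> *; lra.
Qed.

End Multiplicativity.

(** * The unitary group generated by [D] *)

Section UnitaryGroup.
Context (R : realType) (H : hilbertType R).
Implicit Types (E : pvm H) (f : measurableTypeR R -> R[i]) (x y : H -> H).
Implicit Types (U : R -> H -> H) (D : operator H).

(** The difference of the two sides is sesquilinear in [h] and [k], so polarization reduces the
    claim to [h = k], where it is conjugation under the integral. *)
Lemma spectral_integral_conj E f x y : bounded_borel f ->
  spectral_integral E f x -> spectral_integral E (fun s => Num.conj (f s)) y ->
  forall h k, '[x h, k] = '[h, y k].
Proof.
move=> bf [[lx _] xE] [[ly _] yE] h k; have [_ mIm _] := bf.
suff: '[x h, k] - '[h, y k] = 0 by move/eqP; rewrite subr_eq0 => /eqP.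
apply: (polarization0 (B := fun u v => '[x u, v] - '[u, y v])) =>
    [u v w|u v w|u v|u v|u] /=.
- by rewrite (linopD lx) !innerDl opprD addrACA.
- by rewrite (linopD ly) !innerDr opprD addrACA.
- by rewrite (linopZ lx) !innerZl mulrBr.
- by rewrite (linopZ ly) !innerZr conj_i mulrBr.
- apply/eqP; rewrite subr_eq0; apply/eqP.
  rewrite (innerC u (y u)) xE yE; apply: complex_ReIm => /=.
    by apply: eq_Rintegral => s _; case: (f s).
  transitivity (- \int[spectral_dist E u]_s (-1 * complex.Im (f s))).
    rewrite RintegralZl ?mulN1r ?opprK//.
    by apply: spectral_integrable => //; exact: bounded_borel_Im.
  by congr (- _); apply: eq_Rintegral => s _; rewrite mulN1r; case: (f s).
Qed.

Definition cis (t : R) (s : measurableTypeR R) : R[i] :=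
  cos (t * s) +i* sin (t * s).

Lemma cisD t t' : cis (t + t') = (fun s => cis t s * cis t' s).
Proof.
apply/funext => s; apply: complex_ReIm; rewrite /cis mulrDl.
  by rewrite Re_mul /= cosD.
by rewrite Im_mul /= sinD addrC (mulrC (cos _)) mulrC [X in X + _]mulrC.
Qed.

Lemma cisN t : cis (- t) = (fun s => Num.conj (cis t s)).
Proof. by apply/funext => s; rewrite /cis mulNr cosN sinN. Qed.

Lemma bounded_borel_cis t : bounded_borel (cis t).
Proof.
have mt : measurable_fun setT (fun s : measurableTypeR R => t * (s : R)).
  exact: mulrl_measurable.
split.
- apply: (@measurableT_comp _ _ _ _ _ _ cos) mt.
  by apply: continuous_measurable_fun; exact: continuous_cos.
- apply: (@measurableT_comp _ _ _ _ _ _ sin) mt.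
  by apply: continuous_measurable_fun; exact: continuous_sin.
- by exists 1 => s; rewrite normc_def /= cos2Dsin2 sqrtr1.
Qed.

Definition unitary_group U :=
  [/\ forall t, bounded_operator (U t), U 0 = id,
      forall s t, U (s + t) = U s \o U t &
      forall t h k, '[U t h, k] = '[h, U (- t) k]].

Lemma spectral_unitary_group E U :
  (forall t, spectral_integral E (cis t) (U t)) -> unitary_group U.
Proof.
move=> iU; split=> [t|||t h k]; first by have [] := iU t.
- have [[lU _] U0] := iU 0; apply: quadratic_inj => // h.
  rewrite U0 innerE; apply: complex_ReIm => /=.
    under eq_Rintegral do rewrite mul0r cos0.
    rewrite Rintegral_cst// mul1r.
    rewrite -[in RHS](projT E h); exact: erefl.
  under eq_Rintegral do rewrite mul0r sin0.
  by rewrite Rintegral_cst// mul0r.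
- move=> s t; have := iU (s + t); have := bounded_borel_cis (s + t).
  rewrite cisD => bst ist.
  exact: spectral_integral_mul (bounded_borel_cis s) (bounded_borel_cis t) bst
    (iU s) (iU t) ist.
- apply: spectral_integral_conj (bounded_borel_cis t) (iU t) _ h k.
  by rewrite -cisN.
Qed.

(** Either [xget] returns a family that comes from some spectral resolution, or it returns the
    default, constantly the identity, which also satisfies the group laws. *)
Lemma expi_unitary_group D : unitary_group (expi D).
Proof.
rewrite /expi; case: xgetP => [U _ [E _ iU]|_]; first exact: spectral_unitary_group iU.
split=> // t; split=> //; exists 1 => h; by rewrite mul1r.
Qed.

End UnitaryGroup.

(** * Differentiation along the orbits of [alpha], and the kernels *)

Section KernelStability.
Context (R : realType) (H : hilbertType R) (D : operator H).
Implicit Types (x y : H -> H) (h k : H).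
Local Notation U := (expi D).

Let U_bounded t : bounded_operator (U t).
Proof. by have [] := expi_unitary_group D. Qed.

Let U0 : U 0 = id.
Proof. by have [] := expi_unitary_group D. Qed.

Let UD s t h : U (s + t) h = U s (U t h).
Proof. by have [_ _ ->] := expi_unitary_group D. Qed.

Let U_adj t h k : '[U t h, k] = '[h, U (- t) k].
Proof. by have [_ _ _ ->] := expi_unitary_group D. Qed.

Let sqn_U t h : sqn (U t h) = sqn h.
Proof. by rewrite !sqnE U_adj -UD addNr U0. Qed.

(** The real part gives access to real one-variable calculus, and by [inner_inj] loses no
    information. *)
Definition alpha_form x h k (t : R) : R := complex.Re '[alpha D t x h, k].

Lemma alpha_formE x h k t :
  alpha_form x h k t = complex.Re '[x (U (- t) h), U (- t) k].
Proof. by rewrite /alpha_form /alpha /= U_adj. Qed.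

(** Moves the base point [t] to 0 at the price of rotating [h] and [k], so that weak
    differentiability, a statement at 0, applies at every time. *)
Lemma alpha_formD x h k s t :
  alpha_form x h k (s + t) = alpha_form x (U (- t) h) (U (- t) k) s.
Proof. by rewrite !alpha_formE opprD !UD. Qed.

Lemma alpha_form_at0 x h k : alpha_form x h k 0 = complex.Re '[x h, k].
Proof. by rewrite alpha_formE oppr0 U0. Qed.

(** The bound is uniform in [t] because each [U (- t)] preserves [sqn]. *)
Lemma alpha_form_bounded x h k : bounded_operator x ->
  exists M : R, forall t, alpha_form x h k t <= M.
Proof.
move=> /bounded_operator_sqn[K K0 xK]; exists (K * sqn h + sqn k) => t.
rewrite alpha_formE; have := Re_inner_le (x (U (- t) h)) (U (- t) k).
have := xK (U (- t) h); rewrite !sqn_U.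
have := mulr_ge0 K0 (sqn_ge0 h); have := sqn_ge0 k.
move: (complex.Re _) (sqn (x _)) (K * _) (sqn k) => *; lra.
Qed.

(** The weak limit is taken at the rotated vectors [U (- t) h] and [U (- t) k]; the real difference
    quotient converges since the real part of a complex number is bounded by its modulus. *)
Lemma is_derive_alpha_form x y h k (t : R) : weak_derivative D x y ->
  is_derive t (1 : R) (alpha_form x h k) (alpha_form y h k t).
Proof.
move=> [_ _ xy].
suff cv : r^-1 *: (alpha_form x h k (r *: 1 + t) - alpha_form x h k t)
    @[r --> (0 : R)^'] --> (alpha_form y h k t : R^o).
  by apply: DeriveDef; [apply/cvg_ex; eexists; exact: cv|exact: cvg_lim cv].
have := xy (U (- t) h) (U (- t) k).
move=> /cvgrPdist_lt cv; apply/cvgrPdist_lt => e e0.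
have := cv e%:C; rewrite ltcR => /(_ e0); apply: filterS => r.
rewrite sub0r normrN normr_id => lt_e; rewrite -ltcR; apply: le_lt_trans lt_e.
apply: le_trans (normc_ge_Re _); rewrite lecR distrC.
rewrite [r *: 1]mulr1 alpha_formD -fmorphV /= innerBl innerZl innerBl.
rewrite Re_sub Re_mul /= mul0r subr0 Re_sub.
by rewrite [alpha_form x h k t]alpha_formE [alpha_form y h k t]alpha_formE.
Qed.

Lemma weak_derivative2_eq0 x y :
  weak_derivative D x y -> weak_derivative D y (cst 0) -> y = cst 0.
Proof.
move=> xy y0; apply/funext => h; apply: inner_inj => k.
rewrite linear0l -alpha_form_at0; set c := alpha_form y h k 0.
have yc t : alpha_form y h k t = c.
  apply: is_derive_0_is_cst => s.
  have := is_derive_alpha_form h k s y0.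
  by rewrite alpha_formE /= linear0l.
pose psi (t : R) := alpha_form x h k t - c * t.
have psi0 t : psi t = psi 0.
  apply: is_derive_0_is_cst => s.
  have xs := is_derive_alpha_form h k s xy.
  rewrite yc in xs.
  apply: is_derive_eq; by rewrite /GRing.scale/= mulr1 subrr.
have [bx _ _] := xy; have [M xM] := alpha_form_bounded h k bx.
apply/eqP/negP => /negP c0.
(* At this time the affine function [psi 0 + c * t] takes the value [M + 1], above its bound [M]. *)
have := xM ((M - psi 0 + 1) / c).
have := psi0 ((M - psi 0 + 1) / c); rewrite {1}/psi [c * _]mulrC divfK//.
by move: (alpha_form _ _ _ _) => a; lra.
Qed.

(** Uniqueness here pins down the value that [xget] selects for [delta D (cst 0)]. *)
Lemma weak_derivative_cst0 y : weak_derivative D (cst 0) y <-> y = cst 0.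
Proof.
split=> [y0|->]; last first.
  have b0 : bounded_operator (cst 0 : H -> H).
    split=> [a u v|]; first by rewrite scaler0 addr0.
    by exists 0 => h; rewrite normr0 mul0r.
  split=> // h k.
  rewrite (_ : (fun _ => _) = cst 0); first exact: cvg_cst.
  apply/funext => t; have [lU _] := U_bounded t.
  by rewrite /alpha /= (linop0 lU) !subr0 scaler0 linear0l normr0.
apply/funext => h; apply: inner_inj => k.
have := is_derive_alpha_form h k 0 y0; rewrite alpha_form_at0 linear0l.
rewrite (_ : alpha_form _ h k = cst 0) => [[_ <-]|].
  by rewrite derive_cst.
by apply/funext => t; rewrite alpha_formE linear0l.
Qed.

Lemma delta_weak_derivative x : dom_delta D x -> weak_derivative D x (delta D x).
Proof. by move=> /(xgetPex (cst 0)). Qed.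

Lemma dom_delta0 : dom_delta D (cst 0).
Proof. by exists (cst 0); apply/weak_derivative_cst0. Qed.

Lemma delta0 : delta D (cst 0) = cst 0.
Proof. exact/weak_derivative_cst0/delta_weak_derivative/dom_delta0. Qed.

(** With [z] the [n]-th iterate of [delta D] at [x], the second derivative of [z] vanishes, hence so
    does the first, which is the iterate of order [n.+1]. *)
Lemma ker_delta_powS n : ker_delta_pow D n.+2 `<=` ker_delta_pow D n.+1.
Proof.
move=> x [[bx xdom] x0]; split.
  by split=> // k kn; apply: xdom; exact: ltnW.
rewrite iterS; apply: weak_derivative2_eq0.
  by apply: delta_weak_derivative; apply: xdom; exact: leqnSn.
by rewrite -x0 iterS; apply: delta_weak_derivative; exact: (xdom n.+1).
Qed.

Lemma ker_delta_pow_ker n : ker_delta_pow D n.+1 `<=` ker_delta D.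
Proof.
elim: n => [x [[_ xdom] x0]|n IH]; first by split=> //; exact: (xdom 0%N).
by move=> x /ker_delta_powS/IH.
Qed.

(** All iterates after the zeroth are zero, and zero lies in the domain, so the domain conditions
    hold at every order. *)
Lemma ker_ker_delta_pow n : ker_delta D `<=` ker_delta_pow D n.+1.
Proof.
move=> x [xdom x0]; have iter0 m : iter m.+1 (delta D) x = cst 0.
  by elim: m => [//|m IHm]; rewrite iterS IHm delta0.
split=> //; split=> [|[|m] _]; rewrite ?iter0 //; last exact: dom_delta0.
by have [y []] := xdom.
Qed.

End KernelStability.

Theorem theorem3p5 (R : realType) (H : hilbertType R) (D : operator H)
    (Dsa : self_adjoint D) (n : nat) (n_gt0 : (0 < n)%N) :
  ker_delta_pow D n = ker_delta D.
Proof.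
case: n n_gt0 => // n _.
by apply/seteqP; split; [exact: ker_delta_pow_ker|exact: ker_ker_delta_pow].
Qed.
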